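(* Let $\ell\in[1,\infty)$ be a real number, let $p\in[0,1]$, and let $W$ be a random variable with the negative binomial distribution $nb(p,\ell)$. Then for every integer $k\ge 0$, $$\Phi\left(G_{nb(p,\ell)}(k)\right)\leq\Pr\left(W\leq k\right),$$ where $G_{nb(p,\ell)}$ denotes the signed log-likelihood of $nb(p,\ell)$ and $\Phi$ is the distribution function of the standard Gaussian.
   Context: For $\ell>0$ real and $0<p\le1$, $nb(p,\ell)$ is the distribution on $\{0,1,2,\dots\}$ with point probabilities $\Pr(W=k)=\frac{\ell(\ell+1)\cdots(\ell+k-1)}{k!}p^{\ell}(1-p)^k$ (for integer $\ell$: the number of failures before the $\ell$-th success in a Bernoulli process with success probability $p$; for $p=1$ it is the point mass at $0$, with $0^0=1$). Its mean is $\mu=\ell\frac{1-p}{p}$. In the degenerate case $p=0$ no success ever occurs, so $W=\infty$ almost surely and $\mu=\infty$. For fixed $\ell$ and $0<p<1$ these distributions form an exponential family, and the member with mean $k$ is $nb(\hat p,\ell)$ with $\hat p=\frac{\ell}{k+\ell}$ (for $k=0$ this is the limiting case $\hat p=1$). The information divergence is $$D\left(nb(p_1,\ell)\,\Vert\, nb(p_2,\ell)\right)=\frac{\ell}{p_1}\left(p_1\ln\frac{p_1}{p_2}+(1-p_1)\ln\frac{1-p_1}{1-p_2}\right),$$ with the conventions $0\ln\frac{0}{a}=0$ for $a\ge 0$ and $a\ln\frac{a}{0}=+\infty$ for $a>0$. The signed log-likelihood is $$G_{nb(p,\ell)}(k)=\begin{cases}-\left(2D\left(nb(\hat p,\ell)\Vert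 nb(p,\ell)\right)\right)^{1/2}, & k<\mu,\\ +\left(2D\left(nb(\hat p,\ell)\Vert nb(p,\ell)\right)\right)^{1/2}, & k\ge\mu,\end{cases}\qquad \hat p=\frac{\ell}{k+\ell},$$ with $\Phi(-\infty)=0$ and $\Phi(+\infty)=1$. *)

(* Defs.v *)
From mathcomp Require Import all_boot all_order all_algebra.
From mathcomp Require Import all_classical all_reals all_analysis.
From mathcomp Require Import measurable_realfun.

Set Implicit Arguments.
Unset Strict Implicit.
Unset Printing Implicit Defensive.

Import Order.TTheory GRing.Theory Num.Theory.
Import numFieldNormedType.Exports.

Local Open Scope classical_set_scope.
Local Open Scope ring_scope.

Section negative_binomial.
Context {R : realType}.
Implicit Types (p l : R) (k : nat).

(* [0 ^+ 0 = 1] in MathComp, so [nb_pmf 1 l] is the point mass at 0. *)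
Definition nb_pmf p l k : R :=
  (\prod_(i < k) (l + i%:R)) / k`!%:R * p `^ l * (1 - p) ^+ k.

(* The distribution nb(p, l), as a set function on the extended reals: it
   is carried by {0, 1, 2, ...} if p != 0, and is the point mass at +oo if
   p = 0. *)
Definition nb_prob p l (A : set (\bar R)) : \bar R :=
  if p == 0 then \d_(+oo%E : \bar R) A
  else (\esum_(k in [set k | A k%:R%:E]) (nb_pmf p l k)%:E)%E.

Definition nb_mean p l : \bar R :=
  if p == 0 then +oo%E else (l * ((1 - p) / p))%:E.

(* a ln (a / b) for a, b >= 0, with 0 ln (0 / b) = 0 and, for a > 0,
   a ln (a / 0) = +oo. *)
Definition xlnxy (a b : R) : \bar R :=
  if a == 0 then 0%E else if b == 0 then +oo%E else (a * ln (a / b))%:E.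

(* D(nb(p1, l) || nb(p2, l)), for 0 < p1 <= 1 and 0 <= p2 <= 1. *)
Definition nb_div p1 p2 l : \bar R :=
  ((l / p1)%:E * (xlnxy p1 p2 + xlnxy (1 - p1) (1 - p2)))%E.

(* The parameter of the member of the family with mean k. *)
Definition nb_hat l k : R := l / (k%:R + l).

Definition nb_G p l k : \bar R :=
  let s := sqrte (2%:E * nb_div (nb_hat l k) p l)%E in
  if (k%:R%:E < nb_mean p l)%E then (- s)%E else s.

End negative_binomial.

(* The distribution function of the standard Gaussian, extended to the
   extended reals by its limits. *)
Definition gaussPhi {R : realType} (x : \bar R) : \bar R :=
  match x with
  | r%:E => normal_prob 0 1 `]-oo, r]
  | +oo%E => 1%E
  | -oo%E => 0%E
  end.

(* Main.v *)
Require Import Defs.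
From mathcomp Require Import all_boot all_order all_algebra.
From mathcomp Require Import all_classical all_reals all_analysis.
From mathcomp Require Import measurable_realfun.
From mathcomp Require Import ring lra.

Import Order.TTheory GRing.Theory Num.Theory.
Import numFieldNormedType.Exports.

Local Open Scope classical_set_scope.
Local Open Scope ring_scope.

(* Fix l and k > 0, and let q = l / (k + l).  As functions of p, both the
   distribution function F(p) = Pr(W <= k) and H(p) = Phi(G_p(k)) increase from
   0 to 1 on ]0, 1[.  The derivative of F telescopes to
   c p^(l-1) (1-p)^k, and that of H is A p^(l-1) (1-p)^k |p - q| /
   ((1-p) |G_p(k)|), because exp(-D) is proportional to p^l (1-p)^k.  Hence
   (H - F)' has the sign of E = A^2 ((p-q)/(1-p))^2 - c^2 G^2, and
   E' = 2 (p-q) / (p (1-p)^3) * h with h increasing in p.  As E(q) = 0, it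
   follows that H - F decreases up to some point and increases afterwards;
   since it tends to 0 at both ends, H <= F.  To avoid differentiating G at q,
   where D vanishes, the two sides of q are treated separately, with
   G = -sqrt(2D) on the left and G = sqrt(2D) on the right.  For k = 0 the claim
   is the tail bound Phi(-x) <= exp(-x^2/2), since F(p) = p^l = exp(-D). *)

(** * Monotonicity from the sign of a derivative *)

Lemma derive_ge0_le {R : realType} (f df : R -> R) (a b : R) : a <= b ->
  (forall x, a <= x <= b -> {for x, continuous f}) ->
  (forall x, a < x < b -> is_derive x 1 f (df x)) ->
  (forall x, a < x < b -> 0 <= df x) -> f a <= f b.
Proof.
rewrite le_eqVlt => /predU1P[<-//|ab] cf dfE df0.
have dfab x : x \in `]a, b[ -> is_derive x 1 f (df x).
  by rewrite in_itv/= => /dfE.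
have cfab : {within `[a, b], continuous f}.
  apply: continuous_in_subspaceT => x /set_mem /=.
  by rewrite in_itv/= => /cf.
have [c] := MVT ab dfab cfab.
rewrite in_itv/= => /df0 c0 fE.
by rewrite -subr_ge0 fE mulr_ge0// subr_ge0 ltW.
Qed.

Lemma derive_le0_ge {R : realType} (f df : R -> R) (a b : R) : a <= b ->
  (forall x, a <= x <= b -> {for x, continuous f}) ->
  (forall x, a < x < b -> is_derive x 1 f (df x)) ->
  (forall x, a < x < b -> df x <= 0) -> f b <= f a.
Proof.
move=> ab cf dfE df0; rewrite -lerN2.
apply: (@derive_ge0_le R (fun x => - f x) (fun x => - df x) a b ab) => x axb.
- exact/continuousN/cf.
- exact/is_deriveN/dfE.
- by rewrite oppr_ge0 df0.
Qed.

Lemma is_derive1_continuous {R : realType} (f : R -> R) (x a : R) :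
  is_derive x 1 f a -> {for x, continuous f}.
Proof. by case=> dfx _; apply/differentiable_continuous/derivable1_diffP. Qed.

(** * The standard Gaussian distribution function *)

Section standard_normal.
Context {R : realType}.
Implicit Types x : R.
Local Notation mu := (@lebesgue_measure R).

Definition std_normal_cdf x : R := fine (normal_prob 0 1 `]-oo, x] : \bar R).

Lemma std_normal_cdfE x :
  (std_normal_cdf x)%:E = normal_prob 0 1 `]-oo, x] :> \bar R.
Proof. by rewrite fineK// fin_num_measure. Qed.

Lemma std_normal_cdf_le1 x : std_normal_cdf x <= 1.
Proof. by rewrite -lee_fin std_normal_cdfE probability_le1. Qed.

Lemma is_derive_std_normal_cdf x :
  is_derive x 1 std_normal_cdf (normal_peak 1 * expR (- x ^+ 2 / 2)).
Proof.
(* [x + 1] only serves as a point beyond [x] up to which the density is integrable. *)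
have := @continuous_FTC1 R (normal_pdf 0 1) -oo%O x (x + 1).
case.
- by rewrite ltrDl.
- by apply: integrableS (integrable_normal_pdf 0 1).
- by rewrite ltNyr.
- exact: continuous_normal_pdf.
move=> dF F'; split => //.
rewrite -derive1E; apply: etrans F' _.
by rewrite normal_pdfE ?oner_neq0// /normal_fun subr0 expr1n.
Qed.

(* On ]-oo, -x] the centered density is at most exp(-x^2/2) times the density
   of mean -x, since t^2 >= x^2 + (t + x)^2 there. *)
Lemma std_normal_cdf_tail x : 0 <= x ->
  std_normal_cdf (- x) <= expR (- x ^+ 2 / 2).
Proof.
move=> x0; rewrite -lee_fin std_normal_cdfE.
suff tilt : (normal_prob 0 1 `]-oo, (- x)%R] <=
    (expR (- x ^+ 2 / 2))%:E * normal_prob (- x) 1 `]-oo, (- x)%R])%E.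
  apply: (le_trans tilt); rewrite -[leRHS]mule1.
  by rewrite lee_pmul// ?probability_le1// lee_fin expR_ge0.
have mpdf (m : R) : measurable_fun `]-oo, (- x)] (fun t : R =>
  (normal_pdf m 1 t)%:E).
  apply/measurable_EFinP; apply: measurable_funTS.
  exact: measurable_normal_pdf.
rewrite /normal_prob -ge0_integralZl//=; last 2 first.
- exact: mpdf.
- by move=> t _; rewrite lee_fin normal_pdf_ge0.
apply: ge0_le_integral => //=.
- by move=> t _; rewrite lee_fin normal_pdf_ge0.
- exact: mpdf.
- by apply: emeasurable_funM => //; exact: mpdf.
move=> t; rewrite in_itv/= => tx.
rewrite lee_fin !normal_pdfE ?oner_neq0// mulrCA ler_pM2l ?normal_peak_gt0
  ?oner_neq0//.
rewrite /normal_fun -expRD ler_expR expr1n opprK subr0.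
(* The comparison of exponents reduces to x (t + x) <= 0. *)
nra.
Qed.

End standard_normal.

(** * The negative binomial distribution function and its derivative in [p] *)

Section negative_binomial_cdf.
Context {R : realType}.
Implicit Types (l p : R) (k : nat).

Definition nb_cdf l k p : R := \sum_(i < k.+1) nb_pmf p l i.

(** The generalized binomial coefficient l + k - 1 over k. *)
Definition nb_coef l k : R := (\prod_(i < k) (l + i%:R)) / k`!%:R.

Lemma nb_coef_gt0 l k : 0 < l -> 0 < nb_coef l k.
Proof.
move=> l0; rewrite divr_gt0 ?ltr0n ?fact_gt0//.
by rewrite prodr_gt0// => i _; rewrite ltr_wpDr.
Qed.

Lemma nb_coefS l k : nb_coef l k.+1 * k.+1%:R = nb_coef l k * (l + k%:R).
Proof.
rewrite /nb_coef big_ord_recr/= factS natrM.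
have k0 : k.+1%:R != 0 :> R by rewrite pnatr_eq0.
have kf0 : k`!%:R != 0 :> R by rewrite pnatr_eq0 -lt0n fact_gt0.
by field; rewrite nat1r kf0 k0.
Qed.

Lemma nb_pmf_ge0 l k p : 0 < l -> p <= 1 -> 0 <= nb_pmf p l k.
Proof.
move=> l0 p1; rewrite /nb_pmf mulr_ge0 ?exprn_ge0 ?subr_ge0//.
by rewrite mulr_ge0 ?powR_ge0//; apply/ltW/nb_coef_gt0.
Qed.

Lemma nb_cdf_ge0 l k p : 0 < l -> p <= 1 -> 0 <= nb_cdf l k p.
Proof. by move=> l0 p1; apply: sumr_ge0 => i _; apply: nb_pmf_ge0. Qed.

Lemma nb_cdf1 l k : nb_cdf l k 1 = 1.
Proof.
rewrite /nb_cdf big_ord_recl big1 => [|i _]; rewrite /nb_pmf subrr.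
  by rewrite big_ord0 fact0 powR1 expr0 divr1 !mulr1 addr0.
by rewrite lift0 expr0n mulr0.
Qed.

(** At [k = 0] the truncated exponent [k.-1] is harmless, because its term carries the factor
    [k%:R]. *)
Lemma is_derive_nb_pmf l k p : 0 < p ->
  is_derive p 1 (fun x => nb_pmf x l k)
    (nb_coef l k * p `^ (l - 1) * (l * (1 - p) ^+ k - k%:R * p *
      (1 - p) ^+ k.-1)).
Proof.
move=> p0; rewrite /nb_pmf -/(nb_coef l k).
have d1 := @is_derive1_powR R l p p0.
have d2 : is_derive p (1 : R) (fun x : R => (1 - x) ^+ k) (- (k%:R *
  (1 - p) ^+ k.-1)).
  have d : is_derive p (1 : R) (fun x : R => 1 - x) (-1).
    by apply: is_derive_eq; rewrite add0r mul1r.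
  have -> : (fun x : R => (1 - x) ^+ k) = (fun x : R => 1 - x) ^+ k.
    by apply/funext => x; rewrite exprfctE.
  apply: (is_derive_eq (is_deriveX k d)).
  by rewrite /GRing.scale/= mulrN1.
have d3 := is_deriveM d1 d2.
have -> : (fun x : R => nb_coef l k * x `^ l * (1 - x) ^+ k) =
   nb_coef l k *: ((fun x : R => x `^ l) * (fun x : R => (1 - x) ^+ k)).
  by apply/funext => x; rewrite -mulrA.
apply: (is_derive_eq (is_deriveZ _ d3)).
have -> : p `^ l = p `^ (l - 1) * p.
  by rewrite -[in LHS](subrK 1 l) [LHS]powRD ?(gt_eqF p0) ?implybT// powRr1//
    ltW.
rewrite /=.
rewrite /GRing.scale/=; ring.
Qed.

(* The derivatives of the terms telescope. *)
Lemma is_derive_nb_cdf l k p : 0 < p ->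
  is_derive p 1 (nb_cdf l k)
    (nb_coef l k * (l + k%:R) * p `^ (l - 1) * (1 - p) ^+ k).
Proof.
move=> p0; elim: k => [|k IH].
  have -> : nb_cdf l 0 = fun x => nb_pmf x l 0.
    by apply/funext => x; rewrite /nb_cdf big_ord_recl big_ord0 addr0.
  apply: (is_derive_eq (is_derive_nb_pmf l 0 p p0)).
  by rewrite !expr0; ring.
have -> : nb_cdf l k.+1 = nb_cdf l k + (fun x => nb_pmf x l k.+1).
  by apply/funext => x; rewrite /nb_cdf big_ord_recr.
apply: (is_derive_eq (is_deriveD IH (is_derive_nb_pmf l k.+1 p p0))).
(* By [nb_coefS] the earlier terms contribute k + 1 times the new coefficient; with the -(k + 1) p
   of the new term this gives (k + 1) (1 - p), hence the next power of 1 - p. *)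
rewrite -nb_coefS /= exprS -natr1; ring.
Qed.

End negative_binomial_cdf.

(** * Comparison of the two distribution functions for [k > 0] *)

Section likelihood_crossing.
Context {R : realType} (l : R) (k : nat) (l_gt0 : 0 < l) (k_gt0 : (0 < k)%N).
Implicit Types p x : R.
Local Notation q := (nb_hat l k).
Local Notation n := (k%:R + l).

(** The divergence [nb_div q p l] as a real number: since l / q = k + l, the weights q and 1 - q
    become l and k. *)
Definition nb_rdiv p : R :=
  l * (ln q - ln p) + k%:R * (ln (1 - q) - ln (1 - p)).

Let k_gt0R : 0 < k%:R :> R. Proof. by rewrite ltr0n. Qed.

Let n_gt0 : 0 < n. Proof. by rewrite addr_gt0. Qed.

Let n_hat : n * q = l.
Proof. by rewrite /nb_hat mulrC divfK ?gt_eqF. Qed.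

Let q_gt0 : 0 < q. Proof. by rewrite divr_gt0. Qed.

Let q_lt1 : q < 1.
Proof. by rewrite ltr_pdivrMr// mul1r ltrDr. Qed.

Lemma nb_rdiv_hat : nb_rdiv q = 0.
Proof. by rewrite /nb_rdiv !subrr !mulr0 addr0. Qed.

Lemma is_derive_nb_rdiv p : 0 < p < 1 ->
  is_derive p 1 nb_rdiv (n * (p - q) / (p * (1 - p))).
Proof.
move=> /andP[p0 p1].
have p1' : 0 < 1 - p by rewrite subr_gt0.
have d : is_derive p (1 : R) (fun x : R => 1 - x) (-1).
  by apply: is_derive_eq; rewrite add0r mul1r.
have d1 : is_derive p (1 : R) (fun x : R => ln q - ln x) (- p^-1).
  have d1 := is_deriveB (is_derive_cst (ln q) p 1) (is_derive1_ln p0).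
  by apply: (is_derive_eq d1); rewrite sub0r.
have d2 : is_derive p (1 : R) (fun x : R => ln (1 - q) - ln (1 - x))
  ((1 - p)^-1).
  have d2 := @is_derive1_comp R (@ln R) (fun x : R => 1 - x) p _ _
    (is_derive1_ln p1') d.
  have d3 := is_deriveB (is_derive_cst (ln (1 - q)) p 1) d2.
  by apply: (is_derive_eq d3); rewrite sub0r mulrN1 opprK.
apply: (is_derive_eq (is_deriveD (is_deriveZ l d1) (is_deriveZ k%:R d2))).
rewrite /GRing.scale/= mulrBr n_hat; field.
by rewrite !gt_eqF.
Qed.

(** The bound ln x - ln y > 1 - y / x, a form of e^t > 1 + t, applies to both terms, and the two
    lower bounds add up to 0. *)
Lemma nb_rdiv_gt0 p : 0 < p < 1 -> p != q -> 0 < nb_rdiv p.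
Proof.
move=> /andP[p0 p1] pq.
have lnB x y : 0 < x -> 0 < y -> x != y -> 1 - y / x < ln x - ln y.
  move=> x0 y0 xy.
  have yx : ln (y / x) != 0.
    rewrite ln_eq0 ?divr_gt0//; apply: contra xy => /eqP yx1.
    by rewrite -[y](divfK (lt0r_neq0 x0)) yx1 mul1r.
  have := expR_gt1Dx yx; rewrite lnK ?posrE ?divr_gt0// ln_div ?posrE//.
  lra.
have q1' : 0 < 1 - q by rewrite subr_gt0.
have p1' : 0 < 1 - p by rewrite subr_gt0.
have A := lnB q p q_gt0 p0 ltac:(by rewrite eq_sym).
have B : 1 - (1 - p) / (1 - q) < ln (1 - q) - ln (1 - p).
  by apply: lnB => //; apply: contra pq => /eqP qp; apply/eqP; lra.
have -> : 0 = l * (1 - p / q) + k%:R * (1 - (1 - p) / (1 - q)) :> R.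
  have kE : k%:R = n * (1 - q) by rewrite mulrBr mulr1 n_hat addrK.
  rewrite {}kE -{1}n_hat; field.
  by rewrite !gt_eqF.
by rewrite /nb_rdiv ltrD// ltr_pM2l.
Qed.

Lemma nb_rdiv_ge0 p : 0 < p < 1 -> 0 <= nb_rdiv p.
Proof.
move=> p01; have [->|pq] := eqVneq p q; first by rewrite nb_rdiv_hat.
exact/ltW/nb_rdiv_gt0.
Qed.

(** The reciprocal of q^l (1 - q)^k, the maximum of p^l (1 - p)^k. *)
Definition nb_peak : R := expR (- (l * ln q + k%:R * ln (1 - q))).

(** The power p^l is split to exhibit the weight p^(l-1) (1 - p)^k of [is_derive_nb_cdf]. *)
Lemma expR_nb_rdiv p : 0 < p < 1 ->
  expR (- nb_rdiv p) = nb_peak * p `^ (l - 1) * p * (1 - p) ^+ k.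
Proof.
move=> /andP[p0 p1]; have p1' : 0 < 1 - p by rewrite subr_gt0.
have -> : (1 - p) ^+ k = expR (k%:R * ln (1 - p)).
  by rewrite expRM_natl lnK.
have pE : p `^ (l - 1) * p = expR (l * ln p).
  rewrite /powR (gt_eqF p0) -[X in _ * X]lnK// -expRD; congr expR.
  ring.
rewrite -(mulrA nb_peak) pE /nb_peak -!expRD /nb_rdiv; congr expR.
ring.
Qed.

(** [s] is the sign of G, held fixed so that each branch is continuous up to and including [q]. *)
Definition nb_Phi (s p : R) : R :=
  std_normal_cdf (s * Num.sqrt (2 * nb_rdiv p)).

(** The Gaussian density at s sqrt(2D) is a multiple of exp(-D), whose separate factor p cancels the
    p in the denominator of D'. *)
Lemma is_derive_nb_Phi s p : 0 < p < 1 -> p != q -> s ^+ 2 = 1 ->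
  is_derive p 1 (nb_Phi s)
    (normal_peak 1 * nb_peak * n * p `^ (l - 1) * (1 - p) ^+ k *
      (s * (p - q) / ((1 - p) * Num.sqrt (2 * nb_rdiv p)))).
Proof.
move=> p01 pq s1.
have D0 := nb_rdiv_gt0 p p01 pq.
have D20 : 0 < 2 * nb_rdiv p by rewrite mulr_gt0.
have d1 := is_deriveZ (2 : R) (is_derive_nb_rdiv p p01).
have d2 := @is_derive1_comp R Num.sqrt _ p _ _ (is_derive1_sqrt D20) d1.
have d3 := is_deriveZ s d2.
have d4 := @is_derive1_comp R std_normal_cdf _ p _ _
  (is_derive_std_normal_cdf _) d3.
apply: (is_derive_eq d4); rewrite /GRing.scale/=.
rewrite exprMn s1 mul1r sqr_sqrtr ?ltW//.
have -> : - (2 * nb_rdiv p) / 2 = - nb_rdiv p by field.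
rewrite expR_nb_rdiv//.
case/andP: p01 => p0 p1; have p1' : 0 < 1 - p by rewrite subr_gt0.
have sq0 : 0 < Num.sqrt (2 * nb_rdiv p) by rewrite sqrtr_gt0.
set r := Num.sqrt _ in sq0 *.
by field; rewrite !gt_eqF.
Qed.

Lemma continuous_nb_Phi s p : 0 < p < 1 -> {for p, continuous (nb_Phi s)}.
Proof.
move=> p01.
have cD := is_derive1_continuous _ _ _ (is_deriveZ (2 : R)
  (is_derive_nb_rdiv p p01)).
have cS := continuous_comp cD (@sqrt_continuous R _).
have cZ := continuousM (@cst_continuous _ _ s p) cS.
by have := continuous_comp cZ (is_derive1_continuous _ _ _
  (is_derive_std_normal_cdf _)).
Qed.

(** * The sign of the derivative of the gap *)

Local Notation A := (normal_peak 1 * nb_peak * n).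
Local Notation c := (nb_coef l k * (l + k%:R)).

Let A_gt0 : 0 < A.
Proof. by rewrite !mulr_gt0 ?normal_peak_gt0 ?oner_neq0 ?expR_gt0. Qed.

Let c_gt0 : 0 < c.
Proof. by rewrite mulr_gt0 ?nb_coef_gt0// addrC. Qed.

Definition nb_gap (s p : R) : R := nb_Phi s p - nb_cdf l k p.

(* Away from [q], the derivative of [nb_gap s] at [p] has the sign of
   [nb_crossing p], where [s] is the sign of [p - q]. *)
Definition nb_crossing p : R :=
  A ^+ 2 * ((1 - q) / (1 - p) - 1) ^+ 2 - c ^+ 2 * (2 * nb_rdiv p).

(** The increasing factor h in the derivative of [nb_crossing]. *)
Definition nb_crossing_slope p : R :=
  A ^+ 2 * (1 - q) * p - c ^+ 2 * n * (1 - p) ^+ 2.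

Lemma nb_crossing_slope_homo x y : x <= y -> x <= 1 -> y <= 1 ->
  nb_crossing_slope x <= nb_crossing_slope y.
Proof.
move=> xy x1 y1; rewrite /nb_crossing_slope lerD//.
  by rewrite ler_wpM2l// mulr_ge0 ?sqr_ge0// subr_ge0 ltW.
rewrite lerN2; apply: ler_wpM2l; first by rewrite mulr_ge0 ?sqr_ge0// ltW.
by rewrite ler_sqr ?nnegrE ?subr_ge0// lerB.
Qed.

Lemma is_derive_nb_crossing p : 0 < p < 1 ->
  is_derive p 1 nb_crossing
    (2 * (p - q) / (p * (1 - p) ^+ 3) * nb_crossing_slope p).
Proof.
move=> p01; have d1 := is_derive_nb_rdiv p p01.
case/andP: p01 => p0 p1; have p1' : 0 < 1 - p by rewrite subr_gt0.
have d : is_derive p (1 : R) (fun x : R => 1 - x) (-1).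
  by apply: is_derive_eq; rewrite add0r mul1r.
have d2 := @is_deriveV R (fun x : R => 1 - x) p _ _ (lt0r_neq0 p1') d.
have d3 := is_deriveX 2 (is_deriveB (is_deriveZ (1 - q) d2) (is_derive_cst
  (1 : R) p 1)).
have d4 := is_deriveB (is_deriveZ (A ^+ 2) d3) (is_deriveZ (c ^+ 2)
  (is_deriveZ (2 : R) d1)).
apply: (is_derive_eq d4).
rewrite /GRing.scale/= /cst /nb_crossing_slope expr1.
rewrite -[(_ - _ : R -> R) p]/((1 - q) * (1 - p)^-1 - 1).
by field; rewrite !gt_eqF.
Qed.

Let cont_nb_crossing p : 0 < p < 1 -> {for p, continuous nb_crossing}.
Proof. by move=> p01; exact: is_derive1_continuous
  (is_derive_nb_crossing p p01). Qed.

Lemma nb_crossing_hat : nb_crossing q = 0.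
Proof.
by rewrite /nb_crossing nb_rdiv_hat divff ?gt_eqF ?subr_gt0// subrr expr0n
  !mulr0 subrr.
Qed.

Let dfactor_ge0 p : 0 < p < 1 -> q <= p ->
  0 <= 2 * (p - q) / (p * (1 - p) ^+ 3).
Proof.
move=> /andP[p0 p1] qp; have p1' : 0 <= 1 - p by rewrite subr_ge0 ltW.
by rewrite divr_ge0 ?mulr_ge0 ?subr_ge0// ?exprn_ge0// ltW.
Qed.

Let dfactor_le0 p : 0 < p < 1 -> p <= q ->
  2 * (p - q) / (p * (1 - p) ^+ 3) <= 0.
Proof.
move=> /andP[p0 p1] qp; have p1' : 0 <= 1 - p by rewrite subr_ge0 ltW.
rewrite mulr_le0_ge0// ?invr_ge0 ?mulr_ge0 ?exprn_ge0// ?(ltW p0)//.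
by rewrite mulr_ge0_le0// subr_le0.
Qed.

Let dcrossing p := 2 * (p - q) / (p * (1 - p) ^+ 3) * nb_crossing_slope p.

(** This and the next three lemmas treat each side of [q] and each sign of the slope. As the slope
    increases, a nonnegative value at [x] or a nonpositive one at [y] persists on all of [x, y]. *)
Lemma nb_crossing_right_ndecr x y : q <= x -> x <= y -> y < 1 ->
  0 <= nb_crossing_slope x -> nb_crossing x <= nb_crossing y.
Proof.
move=> qx xy y1 hx; have x0 := lt_le_trans q_gt0 qx.
apply: (@derive_ge0_le _ _ dcrossing _ _ xy) => p /andP[xp py].
- by apply: cont_nb_crossing; lra.
- by apply: is_derive_nb_crossing; lra.
- rewrite mulr_ge0 ?dfactor_ge0//; [lra..|].
  by rewrite (le_trans hx)// nb_crossing_slope_homo//; lra.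
Qed.

Lemma nb_crossing_right_nincr x y : q <= x -> x <= y -> y < 1 ->
  nb_crossing_slope y <= 0 -> nb_crossing y <= nb_crossing x.
Proof.
move=> qx xy y1 hy; have x0 := lt_le_trans q_gt0 qx.
apply: (@derive_le0_ge _ _ dcrossing _ _ xy) => p /andP[xp py].
- by apply: cont_nb_crossing; lra.
- by apply: is_derive_nb_crossing; lra.
- rewrite mulr_ge0_le0 ?dfactor_ge0//; [lra..|].
  by rewrite (le_trans _ hy)// nb_crossing_slope_homo//; lra.
Qed.

Lemma nb_crossing_left_nincr x y : 0 < x -> x <= y -> y <= q ->
  0 <= nb_crossing_slope x -> nb_crossing y <= nb_crossing x.
Proof.
move=> x0 xy yq hx; have y1 := le_lt_trans yq q_lt1.
apply: (@derive_le0_ge _ _ dcrossing _ _ xy) => p /andP[xp py].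
- by apply: cont_nb_crossing; lra.
- by apply: is_derive_nb_crossing; lra.
- rewrite mulr_le0_ge0 ?dfactor_le0//; [lra..|].
  by rewrite (le_trans hx)// nb_crossing_slope_homo//; lra.
Qed.

Lemma nb_crossing_left_ndecr x y : 0 < x -> x <= y -> y <= q ->
  nb_crossing_slope y <= 0 -> nb_crossing x <= nb_crossing y.
Proof.
move=> x0 xy yq hy; have y1 := le_lt_trans yq q_lt1.
apply: (@derive_ge0_le _ _ dcrossing _ _ xy) => p /andP[xp py].
- by apply: cont_nb_crossing; lra.
- by apply: is_derive_nb_crossing; lra.
- rewrite mulr_le0 ?dfactor_le0//; [lra..|].
  by rewrite (le_trans _ hy)// nb_crossing_slope_homo//; lra.
Qed.

(** If the slope were positive at [y], [nb_crossing] would decrease from [y] to its value 0 at [q],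
    contradicting negativity. So the slope is nonpositive up to [y], and [nb_crossing] increases
    there. *)
Lemma nb_crossing_left_lt0 x y : 0 < x -> x <= y -> y <= q ->
  nb_crossing y < 0 -> nb_crossing x < 0.
Proof.
move=> x0 xy yq Ey; have [hy|hy] := leP (nb_crossing_slope y) 0.
  by rewrite (le_lt_trans (nb_crossing_left_ndecr x y x0 xy yq hy)).
have := nb_crossing_left_nincr y q (lt_le_trans x0 xy) yq (lexx _) (ltW hy).
by rewrite nb_crossing_hat leNgt Ey.
Qed.

(** Mirror image: a nonpositive slope at [x] would make [nb_crossing] decrease from 0 on [q, x]. *)
Lemma nb_crossing_right_gt0 x y : q <= x -> x <= y -> y < 1 ->
  0 < nb_crossing x -> 0 < nb_crossing y.
Proof.
move=> qx xy y1 Ex; have [hx|hx] := leP (nb_crossing_slope x) 0; last first.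
  by rewrite (lt_le_trans Ex)// nb_crossing_right_ndecr// ltW.
have := nb_crossing_right_nincr q x (lexx _) qx (le_lt_trans xy y1) hx.
by rewrite nb_crossing_hat leNgt Ex.
Qed.

Let dgap (s p : R) := p `^ (l - 1) * (1 - p) ^+ k *
  (A * (s * (p - q) / ((1 - p) * Num.sqrt (2 * nb_rdiv p))) - c).

Lemma is_derive_nb_gap s p : 0 < p < 1 -> p != q -> s ^+ 2 = 1 ->
  is_derive p 1 (nb_gap s) (dgap s p).
Proof.
move=> p01 pq s1; case/andP : (p01) => p0 _.
apply: (is_derive_eq (is_deriveB (is_derive_nb_Phi s p p01 pq s1)
  (is_derive_nb_cdf l k p p0))).
rewrite /dgap; ring.
Qed.

Lemma continuous_nb_gap s p : 0 < p < 1 -> {for p, continuous (nb_gap s)}.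
Proof.
move=> p01; apply: continuousB; first exact: continuous_nb_Phi.
case/andP: p01 => p0 _.
exact: is_derive1_continuous (is_derive_nb_cdf l k p p0).
Qed.

Let wgt_ge0 p : 0 < p < 1 -> 0 <= p `^ (l - 1) * (1 - p) ^+ k.
Proof.
by move=> /andP[p0 p1]; rewrite mulr_ge0 ?powR_ge0// exprn_ge0// subr_ge0 ltW.
Qed.

(** A difference of squares u^2 - v^2, where the bracket in [dgap] is (u - v) / sqrt(2D); for u, v
    >= 0 the signs agree. *)
Let crossingE s p : 0 < p < 1 -> s ^+ 2 = 1 ->
  nb_crossing p = (A * (s * (p - q) / (1 - p))) ^+ 2 - (c * Num.sqrt
    (2 * nb_rdiv p)) ^+ 2.
Proof.
move=> p01 s1; have D0 := nb_rdiv_ge0 p p01.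
rewrite [(c * _) ^+ 2]exprMn sqr_sqrtr ?mulr_ge0// /nb_crossing; congr (_ - _).
case/andP: p01 => p0 p1; have p1' : 0 < 1 - p by rewrite subr_gt0.
rewrite [RHS]exprMn; congr (_ * _);
  rewrite -[in RHS]mulrA [RHS]exprMn s1 mul1r; congr (_ ^+ 2).
by field; rewrite !gt_eqF.
Qed.

Let dgap_ge0 s p : 0 < p < 1 -> 0 < s * (p - q) -> s ^+ 2 = 1 ->
  0 <= nb_crossing p -> 0 <= dgap s p.
Proof.
move=> p01 spq s1; rewrite (crossingE s p p01 s1) subr_ge0 => E0.
have pq : p != q by apply: contraTneq spq => ->; rewrite subrr mulr0 ltxx.
have r0 : 0 < Num.sqrt (2 * nb_rdiv p)
  by rewrite sqrtr_gt0 mulr_gt0// nb_rdiv_gt0.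
rewrite /dgap mulr_ge0 ?wgt_ge0// subr_ge0.
case/andP: p01 => p0 p1; have p1' : 0 < 1 - p by rewrite subr_gt0.
have u0 : 0 <= A * (s * (p - q) / (1 - p)).
  by rewrite ltW// mulr_gt0// divr_gt0.
have v0 : 0 <= c * Num.sqrt (2 * nb_rdiv p) by rewrite ltW// mulr_gt0.
move: E0; rewrite ler_sqr ?nnegrE// => E0.
by rewrite invfM [X in A * X]mulrA [A * (_ / _)]mulrA ler_pdivlMr.
Qed.

Let dgap_le0 s p : 0 < p < 1 -> 0 < s * (p - q) -> s ^+ 2 = 1 ->
  nb_crossing p <= 0 -> dgap s p <= 0.
Proof.
move=> p01 spq s1; rewrite (crossingE s p p01 s1) subr_le0 => E0.
have pq : p != q by apply: contraTneq spq => ->; rewrite subrr mulr0 ltxx.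
have r0 : 0 < Num.sqrt (2 * nb_rdiv p)
  by rewrite sqrtr_gt0 mulr_gt0// nb_rdiv_gt0.
rewrite /dgap mulr_ge0_le0 ?wgt_ge0// subr_le0.
case/andP: p01 => p0 p1; have p1' : 0 < 1 - p by rewrite subr_gt0.
have u0 : 0 <= A * (s * (p - q) / (1 - p)).
  by rewrite ltW// mulr_gt0// divr_gt0.
have v0 : 0 <= c * Num.sqrt (2 * nb_rdiv p) by rewrite ltW// mulr_gt0.
move: E0; rewrite ler_sqr ?nnegrE// => E0.
by rewrite invfM [X in A * X]mulrA [A * (_ / _)]mulrA ler_pdivrMr.
Qed.

(** Either endpoint may be [q], since the derivative is only taken strictly between [a] and [b]. *)
Lemma nb_gap_ndecr s a b : 0 < a -> a <= b -> b < 1 -> s ^+ 2 = 1 ->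
  (forall x, a < x < b -> 0 < s * (x - q)) ->
  (forall x, a < x < b -> 0 <= nb_crossing x) -> nb_gap s a <= nb_gap s b.
Proof.
move=> a0 ab b1 s1 sq E0.
apply: (@derive_ge0_le _ _ (dgap s) _ _ ab) => p apb.
- by apply: continuous_nb_gap; lra.
- apply: is_derive_nb_gap => //; first by lra.
  by apply: contraTneq (sq _ apb) => ->; rewrite subrr mulr0 ltxx.
- by apply: dgap_ge0; [lra|exact: sq| |exact: E0].
Qed.

Lemma nb_gap_nincr s a b : 0 < a -> a <= b -> b < 1 -> s ^+ 2 = 1 ->
  (forall x, a < x < b -> 0 < s * (x - q)) ->
  (forall x, a < x < b -> nb_crossing x <= 0) -> nb_gap s b <= nb_gap s a.
Proof.
move=> a0 ab b1 s1 sq E0.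
apply: (@derive_le0_ge _ _ (dgap s) _ _ ab) => p apb.
- by apply: continuous_nb_gap; lra.
- apply: is_derive_nb_gap => //; first by lra.
  by apply: contraTneq (sq _ apb) => ->; rewrite subrr mulr0 ltxx.
- by apply: dgap_le0; [lra|exact: sq| |exact: E0].
Qed.

(** * Behaviour at the ends of ]0, 1[ and the global sign of the gap *)

Lemma nb_gap_cvg0 e p : 0 < e -> 0 < p < 1 ->
  exists2 x, 0 < x <= p & nb_gap (-1) x <= e.
Proof.
(* The second bound on [x] says nb_peak x^l <= e; with (1 - x)^k <= 1 it gives exp(-D) <= e, and the
   Gaussian tail bound applies. *)
move=> e0 p01; pose x := Num.min p (expR ((ln e - ln nb_peak) / l)).
have x0 : 0 < x by rewrite lt_min expR_gt0 andbT; case/andP: p01.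
have xp : x <= p by rewrite ge_min lexx.
have x01 : 0 < x < 1 by lra.
exists x; first by rewrite x0.
rewrite /nb_gap lerBlDr (@le_trans _ _ e)//; last first.
  by rewrite lerDl nb_cdf_ge0//; lra.
have D0 := nb_rdiv_ge0 x x01.
rewrite /nb_Phi mulN1r (le_trans (std_normal_cdf_tail _ (sqrtr_ge0 _)))//.
rewrite sqr_sqrtr ?mulr_ge0//.
have -> : - (2 * nb_rdiv x) / 2 = - nb_rdiv x by field.
rewrite -[leRHS]lnK// ler_expR.
have lnx : l * ln x <= ln e - ln nb_peak.
  rewrite mulrC -ler_pdivlMr// -[leRHS]expRK ler_ln ?posrE ?expR_gt0//.
  by rewrite ge_min lexx orbT.
have ln1x : k%:R * ln (1 - x) <= 0.
  by rewrite mulr_ge0_le0// ln_le0//; lra.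
move: lnx; rewrite /nb_rdiv /nb_peak expRK.
lra.
Qed.

(** Bounding Phi by 1 leaves 1 - F, which is small because F is continuous at 1, where
    [is_derive_nb_cdf] still holds. *)
Lemma nb_gap_cvg1 e p : 0 < e -> 0 < p < 1 ->
  exists2 x, p <= x < 1 & nb_gap 1 x <= e.
Proof.
move=> e0 /andP[p0 p1].
have cF := is_derive1_continuous _ _ _ (is_derive_nb_cdf l k 1 ltr01).
have {}cF : nb_cdf l k x @[x --> 1^'-] --> nb_cdf l k 1.
  exact: cvg_at_left_filter.
move/cvgrPdist_le : cF => /(_ e e0) cF.
near (1 : R)^'- => x; exists x.
  apply/andP; split; near: x; last exact: nbhs_left_lt.
  exact: nbhs_left_ge.
rewrite /nb_gap lerBlDr.
apply: (le_trans (std_normal_cdf_le1 _)); rewrite -lerBlDr -(nb_cdf1 l k).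
apply: (le_trans (ler_norm _)).
by near: x.
Unshelve. all: by end_near. Qed.

Let gap_hat : nb_gap (-1) q = nb_gap 1 q.
Proof. by rewrite /nb_gap /nb_Phi nb_rdiv_hat mulr0 sqrtr0 !mulr0. Qed.

Let sign_left x : x < q -> 0 < -1 * (x - q).
Proof. by move=> xq; rewrite mulN1r oppr_gt0 subr_lt0. Qed.

Let sign_right x : q < x -> 0 < 1 * (x - q).
Proof. by move=> qx; rewrite mul1r subr_gt0. Qed.

(** The gap decreases on ]0, p] and is at most any e > 0 somewhere near 0. *)
Let gap_left p : 0 < p <= q ->
  (forall x, 0 < x < p -> nb_crossing x <= 0) -> nb_gap (-1) p <= 0.
Proof.
move=> /andP[p0 pq] E0; apply/ler_addgt0Pr => e e0; rewrite add0r.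
have p01 : 0 < p < 1 by have := q_gt0; have := q_lt1; lra.
have [x /andP[x0 xp]] := nb_gap_cvg0 e p e0 p01.
apply: le_trans; apply: nb_gap_nincr => //; first by lra.
- by rewrite sqrrN expr1n.
- by move=> y /andP[xy yp]; apply: sign_left; lra.
- by move=> y /andP[xy yp]; apply: E0; lra.
Qed.

Let gap_right p : q <= p < 1 ->
  (forall x, p < x < 1 -> 0 <= nb_crossing x) -> nb_gap 1 p <= 0.
Proof.
move=> /andP[qp p1] E0; apply/ler_addgt0Pr => e e0; rewrite add0r.
have p01 : 0 < p < 1 by have := q_gt0; have := q_lt1; lra.
have [x /andP[px x1]] := nb_gap_cvg1 e p e0 p01.
apply: le_trans; apply: nb_gap_ndecr => //; first by lra.
- by rewrite expr1n.
- by move=> y /andP[xy yp]; apply: sign_right; lra.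
- by move=> y /andP[xy yp]; apply: E0; lra.
Qed.

(** The sign of the slope at [q] tells on which side of [q] a sign change of [nb_crossing] may
    occur; the other side is settled first and yields the bound at [q]. *)
Lemma nb_gap_le0 p : 0 < p < 1 -> nb_gap (if p < q then -1 else 1) p <= 0.
Proof.
move=> p01; case/andP: (p01) => p0 p1.
have [hq|/ltW hq] := leP 0 (nb_crossing_slope q).
  have Eright x : q <= x < 1 -> 0 <= nb_crossing x.
    move=> /andP[qx x1]; rewrite -nb_crossing_hat.
    exact: nb_crossing_right_ndecr.
  have gright x : q <= x < 1 -> nb_gap 1 x <= 0.
    by move=> qx; apply: gap_right => // y xy; apply: Eright; lra.
  case: ltP => [pq|qp]; last by apply: gright; lra.
  have [Ep|Ep] := ltP (nb_crossing p) 0.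
    apply: gap_left => [|x /andP[x0 xp]]; first by lra.
    by apply/ltW/(nb_crossing_left_lt0 x p) => //; lra.
  (* Now [nb_crossing] is nonnegative from [p] to [q], so the gap increases up to [q], where both
     branches agree. *)
  apply: (@le_trans _ _ (nb_gap (-1) q));
    last by rewrite gap_hat gright// lexx q_lt1.
  apply: nb_gap_ndecr => //; first exact: ltW.
  - by rewrite sqrrN expr1n.
  - by move=> x /andP[_ xq]; exact: sign_left.
  - move=> x /andP[px xq]; rewrite leNgt; apply/negP => Ex.
    have := nb_crossing_left_lt0 p x p0 (ltW px) (ltW xq) Ex.
    by rewrite ltNge Ep.
have Eleft x : 0 < x <= q -> nb_crossing x <= 0.
  move=> /andP[x0 xq]; rewrite -nb_crossing_hat.
  exact: nb_crossing_left_ndecr.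
have gleft x : 0 < x <= q -> nb_gap (-1) x <= 0.
  by move=> xq; apply: gap_left => // y xy; apply: Eleft; lra.
case: ltP => [pq|qp]; first by apply: gleft; lra.
have [Ep|Ep] := ltP 0 (nb_crossing p).
  apply: gap_right => [|x /andP[px x1]]; first by lra.
  by apply/ltW/(nb_crossing_right_gt0 p x) => //; lra.
apply: (@le_trans _ _ (nb_gap 1 q));
  last by rewrite -gap_hat gleft// lexx q_gt0.
apply: nb_gap_nincr => //.
- by rewrite expr1n.
- by move=> x /andP[qx _]; exact: sign_right.
- move=> x /andP[qx xp]; rewrite leNgt; apply/negP => Ex.
  have := nb_crossing_right_gt0 x p (ltW qx) (ltW xp) p1 Ex.
  by rewrite ltNge Ep.
Qed.

End likelihood_crossing.

(** * Reduction of the signed log-likelihood to [nb_Phi] *)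

Section signed_log_likelihood.
Context {R : realType}.
Implicit Types (l p : R) (k : nat).

Lemma gaussPhi_le1 (x : \bar R) : (gaussPhi x <= 1)%E.
Proof. by case: x => [r| |]//=;
  rewrite -std_normal_cdfE lee_fin std_normal_cdf_le1. Qed.

Lemma nb_divE l k p : 0 < l -> 0 < p < 1 ->
  nb_div (nb_hat l k) p l = (nb_rdiv l k p)%:E.
Proof.
move=> l0 /andP[p0 p1]; have p1' : 0 < 1 - p by rewrite subr_gt0.
have n0 : 0 < k%:R + l by rewrite ltr_wpDl.
have q0 : 0 < nb_hat l k by rewrite divr_gt0.
rewrite /nb_div /xlnxy (gt_eqF q0) (gt_eqF p0) (gt_eqF p1').
have lq : l / nb_hat l k = k%:R + l.
  by rewrite /nb_hat invf_div mulrC divfK// gt_eqF.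
have nq : (k%:R + l) * nb_hat l k = l.
  by rewrite /nb_hat mulrC divfK// gt_eqF.
rewrite lq /nb_rdiv ln_div ?posrE//.
(* 1 - q vanishes only for [k = 0]; the second term is then 0 by convention in [xlnxy], and by its
   factor [k%:R] in [nb_rdiv]. *)
have [q1|q1] := eqVneq (1 - nb_hat l k) 0.
  rewrite adde0 -EFinM mulrA nq; congr EFin.
  suff -> : k%:R = 0 :> R by rewrite mul0r addr0.
  move: q1 => /eqP; rewrite subr_eq0 => /eqP q1.
  by move: nq; rewrite -q1 mulr1; lra.
have q1' : 0 < 1 - nb_hat l k.
  by rewrite lt_neqAle eq_sym q1 subr_ge0 ler_pdivrMr// mul1r lerDr ler0n.
rewrite ln_div ?posrE// -EFinD -EFinM; congr EFin.
have kE : (k%:R + l) * (1 - nb_hat l k) = k%:R by rewrite mulrBr mulr1 nq addrK.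
by rewrite mulrDr mulrA nq mulrA kE.
Qed.

(** Both sides amount to p (k + l) < l; thus the case distinction in [nb_G] is the side of [q]. *)
Lemma lt_nb_mean l k p : 0 < l -> 0 < p ->
  (k%:R%:E < nb_mean p l)%E = (p < nb_hat l k).
Proof.
move=> l0 p0; have n0 : 0 < k%:R + l by rewrite ltr_wpDl.
rewrite /nb_mean (gt_eqF p0) lte_fin mulrA ltr_pdivlMr// ltr_pdivlMr//.
by rewrite mulrBr mulr1 ltrBrDr -mulrDl mulrC.
Qed.

Lemma gaussPhi_nb_G l k p : 0 < l -> 0 < p < 1 ->
  gaussPhi (nb_G p l k) =
    (nb_Phi l k (if p < nb_hat l k then -1 else 1) p)%:E.
Proof.
move=> l0 p01; case/andP: (p01) => p0 p1.
rewrite /nb_G lt_nb_mean// nb_divE//= /nb_Phi.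
by case: ifP => _ /=; rewrite ?mulN1r ?mul1r std_normal_cdfE.
Qed.

Lemma gaussPhi_nb_G_le l k p : 0 < l -> 0 < p <= 1 ->
  (gaussPhi (nb_G p l k) <= (nb_cdf l k p)%:E)%E.
Proof.
move=> l0 /andP[p0]; rewrite le_eqVlt => /predU1P[->|p1].
  by rewrite nb_cdf1 gaussPhi_le1.
have p01 : 0 < p < 1 by rewrite p0.
rewrite gaussPhi_nb_G// lee_fin.
case: k => [|k]; last by rewrite -subr_le0; exact: nb_gap_le0.
(* Every p < 1 lies to the left of q = 1, so the sign is -1. *)
have q1 : nb_hat l 0 = 1 by rewrite /nb_hat add0r divff ?gt_eqF.
rewrite q1 p1 /nb_Phi mulN1r (le_trans (std_normal_cdf_tail _ (sqrtr_ge0 _)))//.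
have -> : nb_rdiv l 0 p = - (l * ln p).
  by rewrite /nb_rdiv q1 ln1 mul0r addr0 sub0r mulrN.
have lnp : ln p <= 0 by rewrite ln_le0// ltW.
rewrite sqr_sqrtr ?mulr_ge0 ?oppr_ge0 ?mulr_ge0_le0 ?(ltW l0)//.
rewrite mulrN opprK mulrC mulrA mulVf ?mul1r ?pnatr_eq0//.
rewrite /nb_cdf big_ord_recl big_ord0 addr0 /nb_pmf big_ord0 fact0 divr1 mul1r.
by rewrite expr0 mulr1 /powR gt_eqF.
Qed.

Lemma nb_prob_le_nat l k p : 0 < l -> 0 < p <= 1 ->
  nb_prob p l [set x | (x <= k%:R%:E)%E] = (nb_cdf l k p)%:E.
Proof.
move=> l0 /andP[p0 p1]; rewrite /nb_prob (gt_eqF p0).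
have -> : [set i | [set x : \bar R | (x <= k%:R%:E)%E] i%:R%:E] = `I_k.+1.
  by apply/seteqP; split=> i /=; rewrite lee_fin ler_nat.
rewrite esum_fset//; last by move=> i _; rewrite lee_fin nb_pmf_ge0.
by rewrite -fsbig_ord sumEFin.
Qed.

End signed_log_likelihood.

Theorem theorem8 (R : realType) (l p : R) (hl : 1 <= l) (hp : 0 <= p <= 1)
    (d : measure_display) (T : measurableType d) (P : probability T R)
    (W : {RV P >-> \bar R})
    (hW : forall A : set (\bar R), measurable A ->
            distribution P W A = nb_prob p l A)
    (k : nat) :
  (gaussPhi (nb_G p l k) <= P [set t | (W t <= k%:R%:E)%E])%E.
Proof.
have l0 : 0 < l by exact: lt_le_trans hl.
case/andP: hp; rewrite le_eqVlt => /predU1P[p0 _|p0 p1].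
  (* For p = 0 the mean is infinite, and so is the divergence because q > 0; hence G is -oo and the
     left side is 0. *)
  have q0 : 0 < nb_hat l k by rewrite divr_gt0// ltr_wpDl.
  rewrite /nb_G /nb_mean /nb_div /xlnxy -p0 eqxx ltry (gt_eqF q0).
  rewrite subr0 oner_eq0 addye; last by case: ifP.
  have lq0 : (0 < (l / nb_hat l k)%:E)%E by rewrite lte_fin divr_gt0.
  by rewrite (gt0_muley lq0) gt0_muley ?lte_fin//= measure_ge0.
have mk : measurable [set x : \bar R | (x <= k%:R%:E)%E].
  have -> : [set x : \bar R | (x <= k%:R%:E)%E] = [set` `]-oo, k%:R%:E]%O].
    by apply/seteqP; split=> x /=; rewrite in_itv.
  exact: emeasurable_itv.
have p01 : 0 < p <= 1 by rewrite p0.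
have := hW _ mk; rewrite (nb_prob_le_nat l k p l0 p01) => WE.
have -> : P [set t | (W t <= k%:R%:E)%E] = (nb_cdf l k p)%:E by rewrite -WE.
exact: gaussPhi_nb_G_le.
Qed.
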